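(* Let $\mathfrak{H}=\mathbb{C}^{I_1\times\cdots\times I_M}$, a finite-dimensional Hilbert space, let $\mathcal{H}\in\mathbb{C}^{I_1\times\cdots\times I_M\times I_1\times\cdots\times I_M}$ be a Hermitian tensor operating on $\mathfrak{H}$, and let $\mathcal{U}_1,\dots,\mathcal{U}_N\in\mathbb{C}^{I_1\times\cdots\times I_M\times I_1\times\cdots\times I_M}$ be tensors satisfying $$\sum_{i=1}^N\mathcal{U}_i^H\star_M\mathcal{U}_i\preceq\mathcal{I},$$ where $\mathcal{I}$ is the identity tensor on $\mathfrak{H}$. Then the map $$(\mathcal{A}_1,\dots,\mathcal{A}_N)\mapsto\mathrm{Tr}\,\exp\Big(\mathcal{H}+\sum_{i=1}^N\mathcal{U}_i^H\star_M(\log\mathcal{A}_i)\star_M\mathcal{U}_i\Big),$$ defined on $N$-tuples of positive-definite tensors $\mathcal{A}_i\in\mathbb{C}^{I_1\times\cdots\times I_M\times I_1\times\cdots\times I_M}$, is jointly concave.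
   Context: The Einstein product of $\mathcal{X}=(a_{i_1,\dots,i_M,j_1,\dots,j_M})$ and $\mathcal{Y}=(b_{j_1,\dots,j_M,k_1,\dots,k_M})$ is $(\mathcal{X}\star_M\mathcal{Y})_{i_1,\dots,i_M,k_1,\dots,k_M}=\sum_{j_1,\dots,j_M}a_{i_1,\dots,i_M,j_1,\dots,j_M}\,b_{j_1,\dots,j_M,k_1,\dots,k_M}$; with it, a tensor in $\mathbb{C}^{I_1\times\cdots\times I_M\times I_1\times\cdots\times I_M}$ acts as a linear operator on $\mathbb{C}^{I_1\times\cdots\times I_M}$. The conjugate transpose is $(\mathcal{X}^H)_{j_1,\dots,j_M,i_1,\dots,i_M}=\overline{a_{i_1,\dots,i_M,j_1,\dots,j_M}}$; $\mathcal{X}$ is Hermitian if $\mathcal{X}^H=\mathcal{X}$. The identity tensor has entries $\prod_k\delta_{i_k,j_k}$. $\mathrm{Tr}(\mathcal{X})=\sum_{i_1,\dots,i_M}\mathcal{X}_{i_1,\dots,i_M,i_1,\dots,i_M}$. $\mathcal{X}\succeq\mathcal{Y}$ means $\mathcal{X}-\mathcal{Y}$ is positive semidefinite. For a Hermitian tensor $\mathcal{X}=\mathcal{V}\star_M\Lambda\star_M\mathcal{V}^H$ with $\mathcal{V}$ unitary and $\Lambda$ diagonal with the eigenvalues as entries, $g(\mathcal{X})=\mathcal{V}\star_M g(\Lambda)\star_M\mathcal{V}^H$, with $g$ applied to the diagonal entries; this defines $\exp$ of Hermitian tensors and $\log$ of positive-definite tensors. *)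

(* Defs.v *)
From HB Require Import structures.
From mathcomp Require Import all_boot all_order all_algebra.
From mathcomp Require Import all_classical all_reals all_analysis.
From mathcomp Require Import complex.

Set Implicit Arguments.
Unset Strict Implicit.
Unset Printing Implicit Defensive.

Import Order.TTheory GRing.Theory Num.Theory.

Local Open Scope classical_set_scope.
Local Open Scope ring_scope.
Local Open Scope convex_scope.

Reserved Notation "X *e Y" (at level 40, left associativity).
Reserved Notation "X ^H" (at level 8, format "X ^H").

Definition midx (M : nat) (I : 'I_M -> nat) : finType :=
  {dffun forall k : 'I_M, 'I_(I k)}.

Definition vtensor (R : realType) (M : nat) (I : 'I_M -> nat) : lmodType R[i] :=
  {ffun midx I -> R[i]}.

(* The entry a_(i_1,...,i_M,j_1,...,j_M) of X is X (i, j). The entrywise product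
   that this type inherits from {ffun _ -> _} is not used. *)
Definition tensor (R : realType) (M : nat) (I J : 'I_M -> nat) :
    lmodType R[i] :=
  {ffun midx I * midx J -> R[i]}.

Definition einprod (R : realType) (M : nat) (I J K : 'I_M -> nat)
    (X : tensor R I J) (Y : tensor R J K) : tensor R I K :=
  [ffun p => \sum_(j : midx J) X (p.1, j) * Y (j, p.2)].

Notation "X *e Y" := (einprod X Y) : ring_scope.

Definition tact (R : realType) (M : nat) (I J : 'I_M -> nat)
    (X : tensor R I J) (x : vtensor R J) : vtensor R I :=
  [ffun i => \sum_(j : midx J) X (i, j) * x j].

Definition tdot (R : realType) (M : nat) (I : 'I_M -> nat)
    (x y : vtensor R I) : R[i] :=
  \sum_(i : midx I) (x i)^* * y i.

Definition tctr (R : realType) (M : nat) (I J : 'I_M -> nat)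
    (X : tensor R I J) : tensor R J I :=
  [ffun p => (X (p.2, p.1))^*].

Notation "X ^H" := (tctr X) : ring_scope.

Definition tid (R : realType) (M : nat) (I : 'I_M -> nat) : tensor R I I :=
  [ffun p : midx I * midx I => \prod_(k < M) (p.1 k == p.2 k)%:R].

Definition ttrace (R : realType) (M : nat) (I : 'I_M -> nat)
    (X : tensor R I I) : R[i] :=
  \sum_(i : midx I) X (i, i).

Definition thermitian (R : realType) (M : nat) (I : 'I_M -> nat)
    (X : tensor R I I) : Prop :=
  X^H = X.

Definition tunitary (R : realType) (M : nat) (I : 'I_M -> nat)
    (V : tensor R I I) : Prop :=
  V^H *e V = tid R I /\ V *e V^H = tid R I.

Definition tdiag (R : realType) (M : nat) (I : 'I_M -> nat)
    (d : midx I -> R) : tensor R I I :=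
  [ffun p => if p.1 == p.2 then (d p.1)%:C%C else 0].

(* On R[i], 0 <= z and 0 < z include that z is real. *)
Definition tpsd (R : realType) (M : nat) (I : 'I_M -> nat)
    (X : tensor R I I) : Prop :=
  thermitian X /\ forall x : vtensor R I, 0 <= tdot x (tact X x).

Definition tposdef (R : realType) (M : nat) (I : 'I_M -> nat)
    (X : tensor R I I) : Prop :=
  thermitian X /\ forall x : vtensor R I, x != 0 -> 0 < tdot x (tact X x).

Definition tle (R : realType) (M : nat) (I : 'I_M -> nat)
    (X Y : tensor R I I) : Prop :=
  tpsd (Y - X).

(* xget selects a tensor Y that satisfies the condition; for a Hermitian X there
   is exactly one (see tfun_exists and tfunE below). *)
Definition tfun (R : realType) (M : nat) (I : 'I_M -> nat) (g : R -> R)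
    (X : tensor R I I) : tensor R I I :=
  xget 0 [set Y | exists (V : tensor R I I) (d : midx I -> R),
    [/\ tunitary V, X = V *e tdiag d *e V^H & Y = V *e tdiag (g \o d) *e V^H]].

Definition texp (R : realType) (M : nat) (I : 'I_M -> nat) (X : tensor R I I) :=
  tfun (@expR R) X.

Definition tlog (R : realType) (M : nat) (I : 'I_M -> nat) (X : tensor R I I) :=
  tfun (@ln R) X.

(* The weights t : {i01 K} satisfy 0 <= t <= 1, hence are real even when
   K = R[i]; x <| t |> y is t *: x + (1 - t) *: y. *)
Definition concave_on (K : numFieldType) (E : lmodType K)
    (D : set (convex_lmodType E)) (f : convex_lmodType E -> K^o) : Prop :=
  [/\ convex_set D,
      {in D, forall x, f x \is Num.real} &
      forall t : {i01 K}, {in D &, forall x y,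
        f x <| t |> f y <= f (x <| t |> y)}].

Section WellDefined.
Local Open Scope sesquilinear_scope.
Context (R : realType) (M : nat).
Implicit Types I J K L : 'I_M -> nat.

Lemma einprodA I J K L (X : tensor R I J) (Y : tensor R J K)
    (Z : tensor R K L) : X *e (Y *e Z) = X *e Y *e Z.
Proof.
apply/ffunP => -[i l]; rewrite !ffunE /=.
under eq_bigr do rewrite ffunE /= big_distrr /=.
rewrite exchange_big /=; apply: eq_bigr => k _.
by rewrite ffunE /= big_distrl /=; apply: eq_bigr => j _; rewrite mulrA.
Qed.

Lemma tidE I (p : midx I * midx I) : tid R I p = (p.1 == p.2)%:R.
Proof.
rewrite ffunE; case: eqP => [->|ne]; first by rewrite big1 // => k _; rewrite eqxx.
have [k kne] : exists k, p.1 k != p.2 k.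
  apply/existsP; rewrite -negb_forall; apply/negP => /forallP e.
  by apply: ne; apply/ffunP => k; apply/eqP.
by rewrite (bigD1 k) //= (negbTE kne) mul0r.
Qed.

Lemma einprod1l I J (X : tensor R I J) : tid R I *e X = X.
Proof.
apply/ffunP => -[i j]; rewrite ffunE /= (bigD1 i) //= tidE /= eqxx mul1r.
by rewrite big1 ?addr0 // => k ki; rewrite tidE /= eq_sym (negbTE ki) mul0r.
Qed.

Lemma einprod1r I J (X : tensor R I J) : X *e tid R J = X.
Proof.
apply/ffunP => -[i j]; rewrite ffunE /= (bigD1 j) //= tidE /= eqxx mulr1.
by rewrite big1 ?addr0 // => k ki; rewrite tidE /= (negbTE ki) mulr0.
Qed.

Lemma einprod_diagl I J (d : midx I -> R) (X : tensor R I J) i j :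
  (tdiag d *e X) (i, j) = (d i)%:C%C * X (i, j).
Proof.
rewrite ffunE /= (bigD1 i) //= ffunE /= eqxx big1 ?addr0 // => k ki.
by rewrite ffunE /= eq_sym (negbTE ki) mul0r.
Qed.

Lemma einprod_diagr I J (d : midx J -> R) (X : tensor R I J) i j :
  (X *e tdiag d) (i, j) = (d j)%:C%C * X (i, j).
Proof.
rewrite ffunE /= (bigD1 j) //= ffunE /= eqxx mulrC big1 ?addr0 // => k ki.
by rewrite ffunE /= (negbTE ki) mulr0.
Qed.

Lemma tfun_unique I (g : R -> R) (V W : tensor R I I) (d e : midx I -> R) :
  tunitary V -> tunitary W ->
  V *e tdiag d *e V^H = W *e tdiag e *e W^H ->
  V *e tdiag (g \o d) *e V^H = W *e tdiag (g \o e) *e W^H.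
Proof.
move=> [V1 V2] [W1 W2] VW.
pose Q := W^H *e V.
have comm : Q *e tdiag d = tdiag e *e Q.
  have /(congr1 (fun Z => W^H *e Z *e V)) := VW.
  rewrite !einprodA W1 einprod1l -[_ *e V^H *e V]einprodA V1 einprod1r.
  by rewrite /Q ?einprodA.
have gcomm : Q *e tdiag (g \o d) = tdiag (g \o e) *e Q.
  apply/ffunP => -[i j]; rewrite einprod_diagr einprod_diagl /=.
  move/ffunP/(_ (i, j)): comm; rewrite einprod_diagr einprod_diagl.
  have [->|Q0] := eqVneq (Q (i, j)) 0; first by rewrite !mulr0.
  by move/(mulIf Q0) => -[->].
have /(congr1 (fun Z => W *e Z *e V^H)) := gcomm.
by rewrite /Q ?einprodA W2 einprod1l -[_ *e V *e V^H]einprodA V2 einprod1r.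
Qed.

Lemma tfunE I (g : R -> R) (V : tensor R I I) (d : midx I -> R) :
  tunitary V ->
  tfun g (V *e tdiag d *e V^H) = V *e tdiag (g \o d) *e V^H.
Proof.
move=> uV; rewrite /tfun; case: xgetP => [Y _ [W [e [uW eX ->]]]|/(_ _)].
  exact/esym/tfun_unique.
by move=> /(_ (V *e tdiag (g \o d) *e V^H)) []; exists V, d.
Qed.

Lemma tfun_exists I (X : tensor R I I) : thermitian X ->
  exists (V : tensor R I I) (d : midx I -> R),
    tunitary V /\ X = V *e tdiag d *e V^H.
Proof.
move=> hX; pose n := #|midx I|.
pose A : 'M[R[i]]_n := \matrix_(a, b) X (enum_val a, enum_val b).
have hA : A \is hermsymmx.
  apply/is_hermitianmxP; rewrite expr0 scale1r; apply/matrixP => a b.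
  by rewrite !mxE -{1}hX ffunE.
have sumE (F : midx I -> R[i]) : \sum_i F i = \sum_(a < n) F (enum_val a).
  by rewrite (reindex _ (onW_bij _ (@enum_val_bij (midx I)))).
set P := spectralmx A; set D := spectral_diag A.
have PU : P \is unitarymx by exact: spectral_unitarymx.
have AE : A = P ^t* *m diag_mx D *m P.
  by rewrite -invmx_unitary //; apply/orthomx_spectralP/hermitian_normalmx.
have Dr : D \is a realmx by exact: hermitian_spectral_diag_real.
pose d i : R := complex.Re (D 0 (enum_rank i)).
have dE a : (d (enum_val a))%:C%C = D 0 a.
  by rewrite /d enum_valK; apply: RRe_real; apply: (mxOverP Dr).
pose V : tensor R I I :=
  [ffun p => (P (enum_rank p.2) (enum_rank p.1))^*].
exists V, d; split; first split.
- apply/ffunP => -[i j]; rewrite tidE ffunE /= sumE.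
  have /unitarymxP/matrixP/(_ (enum_rank i) (enum_rank j)) := PU.
  rewrite !mxE (inj_eq enum_rank_inj) => <-; apply: eq_bigr => a _.
  by rewrite !ffunE /= !mxE enum_valK conjCK.
- apply/ffunP => -[i j]; rewrite tidE ffunE /= sumE.
  have : P ^t* *m P = 1%:M by rewrite -invmx_unitary // mulVmx // unitarymx_unit.
  move/matrixP/(_ (enum_rank i) (enum_rank j)).
  rewrite !mxE (inj_eq enum_rank_inj) => <-; apply: eq_bigr => a _.
  by rewrite !ffunE /= !mxE enum_valK conjCK.
- apply/ffunP => -[i j]; rewrite ffunE /= sumE.
  move/matrixP/(_ (enum_rank i) (enum_rank j)): AE.
  rewrite mxE !enum_rankK => ->; rewrite mxE; apply: eq_bigr => a _.
  rewrite einprod_diagr dE !ffunE /= mul_mx_diag !mxE enum_valK conjCK.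
  by rewrite [_ * D 0 a]mulrC.
Qed.

End WellDefined.

(* Main.v *)
Require Import Defs.
From HB Require Import structures.
From mathcomp Require Import all_boot all_order all_algebra.
From mathcomp Require Import all_classical all_reals all_analysis.
From mathcomp Require Import complex.
From mathcomp Require Import ring lra.

Set Implicit Arguments.
Unset Strict Implicit.
Unset Printing Implicit Defensive.

Import Order.TTheory GRing.Theory Num.Theory.

Local Open Scope classical_set_scope.
Local Open Scope ring_scope.

(** The proof follows Lieb's theorem through two classical steps, both carried
    out in eigenvector coordinates so that only scalar inequalities are needed.

    The first step is the Gibbs variational principle.  For Hermitian K, the
    quantity Tr exp K is the maximum over positive definite T of the free energy
    Tr(K T) - Tr(T log T) + Tr T, attained at T = exp K ([free_energy_le],
    [free_energy_texp]).  A partial maximum of a jointly concave function is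
    concave, so it is enough that the free energy of
    K = H + sum_i U_i^H (log A_i) U_i be jointly concave in (T, A_1, ..., A_N).
    Since 1 - sum_i U_i^H U_i is positive semidefinite, it is U_0^H U_0 for some
    U_0; setting A_0 = 1 and splitting the identity in Tr(1 T log T) shows that
    the free energy is affine in T minus the sum over i = 0, ..., N of
      D_i = Tr(U_i^H U_i T log T) - Tr(U_i^H (log A_i) U_i T)
    ([free_energy_decomposition]).

    The second step is the joint convexity of each relative entropy D_i
    ([rel_entropy_convex]).  If a_j are the eigenvalues of T and b_i those of A,
    the relative entropy is a sum over (i, j) of a_j (ln a_j - ln b_i) with the
    nonnegative weights |x_ij|^2, where x is the matrix of U between the two
    eigenbases.  Riemann sums of the integral over s in [0, 1] of
      (a - b) + (1 - s) (a - b)^2 / ((1 - s) b + s a)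
    approximate a (ln a - ln b) from below.  By completing the square, the
    weighted sum of these kernels is, for each s, a supremum over tensors Z of
    traces in which T and A occur linearly ([minorant]).  So the relative
    entropy is a supremum of functions affine in (T, A), hence convex. *)

(** * Scalar inequalities for the logarithm *)

Section ScalarLog.
Context (R : realType).
Implicit Types a b s : R.

Definition interp s a b := (1 - s) * b + s * a.

Lemma interp_gt0 s a b : 0 <= s <= 1 -> 0 < a -> 0 < b -> 0 < interp s a b.
Proof.
rewrite /interp => /andP[s0 s1] a0 b0.
have [s12|s12] := lerP s (1 / 2).
  have : 0 < (1 - s) * b by apply: mulr_gt0; lra.
  by have := mulr_ge0 s0 (ltW a0); lra.
have : 0 < s * a by apply: mulr_gt0; lra.
have : 0 <= (1 - s) * b by apply: mulr_ge0; lra.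
by lra.
Qed.

Lemma ln_ratio_le a b : 0 < a -> 0 < b -> ln a - ln b <= a / b - 1.
Proof.
move=> a0 b0; rewrite -ln_div ?posrE //.
have ab0 : 0 < a / b by rewrite divr_gt0.
have := expR_ge1Dx (ln (a / b)); rewrite lnK ?posrE //; lra.
Qed.

Lemma ln_ratio_ge a b : 0 < a -> 0 < b -> 1 - b / a <= ln a - ln b.
Proof. by move=> a0 b0; have := ln_ratio_le b0 a0; lra. Qed.

(** The first summand integrates to [a - b], the second to
    [a * (ln a - ln b) - (a - b)] over [s] in [0, 1]. In this form the second
    summand is quadratic in [a - b] over a denominator linear in [(a, b)],
    which is what makes the operator version jointly convex. *)
Definition resolvent_kernel s a b :=
  (a - b) + (1 - s) * ((a - b) ^+ 2 / interp s a b).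

Lemma resolvent_kernelE s a b : 0 < interp s a b ->
  resolvent_kernel s a b = a * ((a - b) / interp s a b).
Proof. by rewrite /resolvent_kernel /interp => w0; field; rewrite gt_eqF. Qed.

(** The nodes are right endpoints. The kernel decreases in [s], so these sums
    stay below the integral. *)
Definition riemann_mean (n : nat) (f : R -> R) :=
  n%:R^-1 * \sum_(k < n) f (k.+1%:R / n%:R).

Lemma node01 (n k : nat) : (k <= n)%N -> (0 < n)%N ->
  0 <= (k%:R / n%:R : R) <= 1.
Proof.
move=> kn n0; rewrite divr_ge0 ?ler0n //= ler_pdivrMr ?ltr0n //.
by rewrite mul1r ler_nat.
Qed.

(** No integral is needed: on each subinterval the inequalities
    [1 - v / u <= ln u - ln v <= u / v - 1] compare the increment of the
    logarithm with the two one-sided Riemann terms, and the total error is the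
    difference of the extreme values of the kernel divided by [n]. *)
Lemma entropy_riemann (n : nat) a b : (0 < n)%N -> 0 < a -> 0 < b ->
  riemann_mean n (fun s => resolvent_kernel s a b) <= a * (ln a - ln b) <=
  riemann_mean n (fun s => resolvent_kernel s a b) + (a - b) ^+ 2 / b / n%:R.
Proof.
move=> n0 a0 b0; have n0R : (0 : R) < n%:R by rewrite ltr0n.
pose w k : R := interp (k%:R / n%:R) a b.
have w_gt0 k : (k <= n)%N -> 0 < w k.
  by move=> kn; apply: interp_gt0 => //; exact: node01.
have dw k : w k.+1 = w k + (a - b) / n%:R.
  by rewrite /w /interp -natr1; field; rewrite gt_eqF.
have w0 : w 0%N = b by rewrite /w /interp; ring.
have wn : w n = a by rewrite /w /interp; field; rewrite gt_eqF.
(* The points w_k divide the segment from b to a evenly, and [ln a - ln b]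
   telescopes along them. *)
have lnE : a * (ln a - ln b) = \sum_(k < n) a * (ln (w k.+1) - ln (w k)).
  rewrite -mulr_sumr -(big_mkord xpredT (fun k => ln (w k.+1) - ln (w k))).
  by rewrite telescope_sumr // wn w0.
have meanE : riemann_mean n (fun s => resolvent_kernel s a b) =
    \sum_(k < n) a * ((a - b) / n%:R / w k.+1).
  rewrite /riemann_mean mulr_sumr; apply: eq_bigr => k _.
  rewrite resolvent_kernelE; last exact: (w_gt0 k.+1 (ltn_ord k)).
  rewrite -/(w k.+1); field.
  by rewrite !gt_eqF // w_gt0.
(* The gap between left and right Riemann sums telescopes too. *)
have errE : (a - b) ^+ 2 / b / n%:R =
    \sum_(k < n) a * ((a - b) / n%:R / w k - (a - b) / n%:R / w k.+1).
  rewrite -mulr_sumr.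
  under eq_bigr do rewrite -mulrBr.
  rewrite -mulr_sumr.
  under eq_bigr do rewrite -opprB.
  rewrite sumrN -(big_mkord xpredT (fun k => (w k.+1)^-1 - (w k)^-1)).
  rewrite telescope_sumr // wn w0; field.
  by rewrite !gt_eqF.
rewrite lnE meanE errE -big_split /=; apply/andP; split; apply: ler_sum => k _.
all: have wk := w_gt0 k (ltnW (ltn_ord k)); have wk1 := w_gt0 k.+1 (ltn_ord k).
all: rewrite -?mulrDr ler_pM2l //.
all: have -> : (a - b) / n%:R = w k.+1 - w k by rewrite dw; ring.
  have := ln_ratio_ge wk1 wk; apply: le_trans.
  by rewrite mulrBl divff ?gt_eqF.
have := ln_ratio_le wk1 wk => /le_trans; apply.
by rewrite addrCA subrr addr0 mulrBl divff ?gt_eqF.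
Qed.

Lemma le_archimedean (x y c : R) :
  (forall n : nat, (0 < n)%N -> x <= y + c / n%:R) -> x <= y.
Proof.
move=> h; apply/ler_addgt0Pr => e e0.
have c0 : 0 <= `|c| / e by rewrite divr_ge0 // ltW.
have := truncnS_gt (`|c| / e); set n := (Num.truncn _).+1 => cn.
apply: le_trans (h n isT) _; rewrite lerD2l.
rewrite ler_pdivrMr ?ltr0n //; apply: le_trans (ler_norm c) _.
by rewrite mulrC -ler_pdivrMr // ltW.
Qed.

End ScalarLog.

(** * Einstein product, adjoint and spectral form *)

Section Tensors.
Context (R : realType) (M : nat).
Implicit Types I J K : 'I_M -> nat.

Lemma einprodDl I J K (X X' : tensor R I J) (Y : tensor R J K) :
  (X + X') *e Y = X *e Y + X' *e Y.
Proof.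
apply/ffunP => p; rewrite !ffunE -big_split; apply: eq_bigr => j _ /=.
by rewrite ffunE mulrDl.
Qed.

Lemma einprodDr I J K (X : tensor R I J) (Y Y' : tensor R J K) :
  X *e (Y + Y') = X *e Y + X *e Y'.
Proof.
apply/ffunP => p; rewrite !ffunE -big_split; apply: eq_bigr => j _ /=.
by rewrite ffunE mulrDr.
Qed.

Lemma einprodZl I J K c (X : tensor R I J) (Y : tensor R J K) :
  (c *: X) *e Y = c *: (X *e Y).
Proof.
apply/ffunP => p; rewrite !ffunE scaler_sumr; apply: eq_bigr => j _.
by rewrite ffunE -scalerAl.
Qed.

Lemma einprodZr I J K c (X : tensor R I J) (Y : tensor R J K) :
  X *e (c *: Y) = c *: (X *e Y).
Proof.
apply/ffunP => p; rewrite !ffunE scaler_sumr; apply: eq_bigr => j _.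
by rewrite ffunE; exact: mulrCA.
Qed.

Lemma tctrK I J (X : tensor R I J) : X^H^H = X.
Proof. by apply/ffunP => -[i j]; rewrite !ffunE /= conjCK. Qed.

Lemma tctrM I J K (X : tensor R I J) (Y : tensor R J K) :
  (X *e Y)^H = Y^H *e X^H.
Proof.
apply/ffunP => p; rewrite !ffunE rmorph_sum; apply: eq_bigr => j _ /=.
by rewrite !ffunE /= rmorphM mulrC.
Qed.

Lemma tctrD I J (X Y : tensor R I J) : (X + Y)^H = X^H + Y^H.
Proof. by apply/ffunP => p; rewrite !ffunE rmorphD. Qed.

Lemma tctr_sum I J (T : Type) (r : seq T) (F : T -> tensor R I J) :
  (\sum_(i <- r) F i)^H = \sum_(i <- r) (F i)^H.
Proof.
apply: (big_morph (fun X : tensor R I J => X^H)); first exact: tctrD.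
by apply/ffunP => p; rewrite !ffunE conjC0.
Qed.

Lemma tctrZ I J (r : R) (X : tensor R I J) : (r%:C%C *: X)^H = r%:C%C *: X^H.
Proof.
by apply/ffunP => p; rewrite !ffunE /= rmorphM; congr (_ * _); exact: conjc_real.
Qed.

Lemma tctr_diag I (d : midx I -> R) : (tdiag d)^H = tdiag d.
Proof.
apply/ffunP => -[i j]; rewrite !ffunE /= eq_sym.
by case: eqP => [->|_]; [exact: conjc_real|rewrite conjC0].
Qed.

Lemma tunitary_id I : tunitary (tid R I).
Proof.
have h : (tid R I)^H = tid R I.
  by apply/ffunP => -[i j]; rewrite ffunE /= !tidE /= eq_sym conjC_nat.
by split; rewrite h einprod1l.
Qed.

Lemma tdiag1 I : tdiag (fun=> 1) = tid R I.
Proof.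
by apply/ffunP => -[i j]; rewrite tidE ffunE /=; case: eqP.
Qed.

Lemma tdiagM I (d e : midx I -> R) :
  tdiag d *e tdiag e = tdiag (fun i => d i * e i).
Proof.
apply/ffunP => -[i j]; rewrite einprod_diagl !ffunE /=; case: eqP => _.
  by rewrite -rmorphM.
by rewrite mulr0.
Qed.

Definition tspec I (V : tensor R I I) (d : midx I -> R) : tensor R I I :=
  V *e tdiag d *e V^H.

Lemma tspec_hermitian I (V : tensor R I I) d : thermitian (tspec V d).
Proof. by rewrite /thermitian /tspec !tctrM tctrK tctr_diag einprodA. Qed.

Lemma thermitian_spec I (X : tensor R I I) : thermitian X ->
  exists V d, tunitary V /\ X = tspec V d.
Proof. exact: tfun_exists. Qed.

Lemma tspec1 I (V : tensor R I I) : tunitary V -> tspec V (fun=> 1) = tid R I.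
Proof. by case=> _ V2; rewrite /tspec tdiag1 einprod1r. Qed.

Lemma tspecM I (V : tensor R I I) d e : tunitary V ->
  tspec V d *e tspec V e = tspec V (fun i => d i * e i).
Proof.
case=> V1 _; rewrite /tspec !einprodA -[_ *e V^H *e V]einprodA V1 einprod1r.
by rewrite -[V *e _ *e tdiag e]einprodA tdiagM.
Qed.

Lemma tlog_spec I (V : tensor R I I) d : tunitary V ->
  tlog (tspec V d) = tspec V (fun i => ln (d i)).
Proof. by move=> uV; rewrite /tlog /tspec tfunE. Qed.

Lemma texp_spec I (V : tensor R I I) d : tunitary V ->
  texp (tspec V d) = tspec V (fun i => expR (d i)).
Proof. by move=> uV; rewrite /texp /tspec tfunE. Qed.

Lemma tact_einprod I J K (X : tensor R I J) (Y : tensor R J K) x :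
  tact (X *e Y) x = tact X (tact Y x).
Proof.
apply/ffunP => i; rewrite !ffunE.
under eq_bigr do rewrite ffunE /= big_distrl /=.
rewrite exchange_big; apply: eq_bigr => j _ /=.
by rewrite ffunE big_distrr; apply: eq_bigr => k _ /=; rewrite mulrA.
Qed.

Lemma tact_id I (x : vtensor R I) : tact (tid R I) x = x.
Proof.
apply/ffunP => i; rewrite ffunE (bigD1 i) //= tidE eqxx mul1r.
by rewrite big1 ?addr0 // => j ji; rewrite tidE /= eq_sym (negbTE ji) mul0r.
Qed.

Lemma tact0 I J (X : tensor R I J) : tact X 0 = 0.
Proof. by apply/ffunP => i; rewrite !ffunE big1 // => j _; rewrite ffunE mulr0. Qed.

Lemma tdot_tact I J (X : tensor R I J) x y :
  tdot x (tact X y) = tdot (tact X^H x) y.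
Proof.
rewrite /tdot; under eq_bigr do rewrite ffunE big_distrr /=.
rewrite exchange_big; apply: eq_bigr => j _ /=.
rewrite ffunE rmorph_sum big_distrl; apply: eq_bigr => i _ /=.
by rewrite ffunE /= rmorphM /= conjCK mulrCA mulrA.
Qed.

Lemma tdot_spec I (V : tensor R I I) d x :
  tdot x (tact (tspec V d) x) =
  \sum_k (d k)%:C%C * (`|tact V^H x k| ^+ 2).
Proof.
rewrite /tspec !tact_einprod tdot_tact; move: (tact V^H x) => y.
apply: eq_bigr => k _.
rewrite [X in _ * X]ffunE (bigD1 k) //= big1 => [|j jk]; last first.
  by rewrite ffunE /= eq_sym (negbTE jk) mul0r.
by rewrite addr0 ffunE /= eqxx normCK mulrCA [_ * (_)^*]mulrC.
Qed.

(** The test vector is the [k]-th column of [V], an eigenvector for [d k]; it is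
    written as the image of a basis vector. *)
Lemma tdot_spec_col I (V : tensor R I I) d k : tunitary V ->
  let x := tact V [ffun i => (i == k)%:R] in
  x != 0 /\ tdot x (tact (tspec V d) x) = (d k)%:C%C.
Proof.
move=> [V1 V2] /=.
have Vx : tact V^H (tact V [ffun i => (i == k)%:R]) = [ffun i => (i == k)%:R].
  by rewrite -tact_einprod V1 tact_id.
split.
  apply/eqP => x0; move: Vx; rewrite x0 tact0 => /ffunP/(_ k).
  by rewrite !ffunE eqxx => /eqP; rewrite eq_sym oner_eq0.
rewrite tdot_spec Vx (bigD1 k) //= ffunE eqxx normr1 expr1n mulr1.
by rewrite big1 ?addr0 // => i ik; rewrite ffunE (negbTE ik) normr0 expr0n mulr0.
Qed.

Lemma tposdef_tspec I (V : tensor R I I) d : tunitary V ->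
  tposdef (tspec V d) <-> forall k, 0 < d k.
Proof.
move=> uV; split=> [[_ pos] k|d0].
  have [x0 xE] := tdot_spec_col d k uV.
  by have := pos _ x0; rewrite xE ltcE => /andP[].
split=> [|x x0]; first exact: tspec_hermitian.
rewrite tdot_spec lt_neqAle; apply/andP; split; last first.
  by apply: sumr_ge0 => k _; rewrite mulr_ge0 ?exprn_ge0 // ler0c ltW.
rewrite eq_sym; apply: contra x0 => /eqP s0.
suff Vx0 : tact V^H x = 0 by rewrite -(tact_id x) -uV.2 tact_einprod Vx0 tact0.
apply/ffunP => k; rewrite [RHS]ffunE; apply/eqP.
have := s0; move/eqP; rewrite psumr_eq0 => [/allP/(_ k)|j _]; last first.
  by rewrite mulr_ge0 ?exprn_ge0 // ler0c ltW.
rewrite mem_index_enum => /(_ isT); rewrite mulf_eq0 expf_eq0 normr_eq0 /=.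
by case/orP => // /eqP[dk]; have := d0 k; rewrite dk ltxx.
Qed.

Lemma tposdefP I (A : tensor R I I) : tposdef A ->
  exists V d, [/\ tunitary V, A = tspec V d & forall k, 0 < d k].
Proof.
move=> Apos; have [V [d [uV AE]]] := tfun_exists Apos.1.
by exists V, d; split=> //; apply/(tposdef_tspec d uV); rewrite /tspec -AE.
Qed.

(** The square root of the eigenvalues gives the factor, as in a Gram matrix. *)
Lemma tpsd_gram I (A : tensor R I I) : tpsd A ->
  exists U : tensor R I I, A = U^H *e U.
Proof.
move=> Apos; have [V [d [uV AE]]] := tfun_exists Apos.1.
have d0 k : 0 <= d k.
  have := Apos.2 (tact V [ffun i => (i == k)%:R]).
  by rewrite AE (tdot_spec_col d k uV).2 ler0c.
exists (tdiag (Num.sqrt \o d) *e V^H).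
rewrite tctrM tctrK tctr_diag einprodA -[V *e _ *e _]einprodA tdiagM AE.
congr (_ *e _ *e _); apply/ffunP => p; rewrite !ffunE /=.
by rewrite -expr2 sqr_sqrtr.
Qed.

Lemma tposdef_id I : tposdef (tid R I).
Proof.
by rewrite -(tspec1 (tunitary_id I)); apply/tposdef_tspec => //; exact: tunitary_id.
Qed.

Lemma tposdef_texp I (X : tensor R I I) : thermitian X -> tposdef (texp X).
Proof.
move=> /thermitian_spec[V [d [uV ->]]]; rewrite texp_spec //.
by apply/tposdef_tspec => // k; exact: expR_gt0.
Qed.

Lemma texpK I (X : tensor R I I) : thermitian X -> tlog (texp X) = X.
Proof.
move=> /thermitian_spec[V [k [uV ->]]]; rewrite texp_spec // tlog_spec //.
by congr (tspec V _); apply/funext => i; rewrite expRK.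
Qed.

Lemma tlog_id I : tlog (tid R I) = 0.
Proof.
rewrite -(tspec1 (tunitary_id I)) tlog_spec; last exact: tunitary_id.
apply/ffunP => -[i j]; rewrite /tspec !ffunE big1 // => k _.
by rewrite einprod_diagr ln1 mul0r mul0r.
Qed.

(** This is the convex combination of the concavity statement, with a real
    weight so that inequalities can be handled in the ordered field [R]. *)
Definition tmix I J (r : R) (X Y : tensor R I J) : tensor R I J :=
  r%:C%C *: X + (1 - r)%:C%C *: Y.

Lemma tmix_id I r (X : tensor R I I) : tmix r X X = X.
Proof. by rewrite /tmix -scalerDl -rmorphD addrC subrK scale1r. Qed.

Lemma tact_mix I J r (X Y : tensor R I J) x :
  tact (tmix r X Y) x = r%:C%C *: tact X x + (1 - r)%:C%C *: tact Y x.
Proof.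
apply/ffunP => i; rewrite !ffunE !scaler_sumr -big_split; apply: eq_bigr => j _ /=.
by rewrite !ffunE mulrDl; congr (_ + _); exact/esym/mulrA.
Qed.

Lemma tposdef_mix I r (A B : tensor R I I) : 0 <= r <= 1 ->
  tposdef A -> tposdef B -> tposdef (tmix r A B).
Proof.
move=> /andP[r0 r1] [hA pA] [hB pB]; split=> [|x x0].
  by rewrite /thermitian /tmix tctrD !tctrZ hA hB.
have -> : tdot x (tact (tmix r A B) x) =
    r%:C%C * tdot x (tact A x) + (1 - r)%:C%C * tdot x (tact B x).
  rewrite tact_mix /tdot !mulr_sumr -big_split; apply: eq_bigr => i _ /=.
  by rewrite !ffunE mulrDr; congr (_ + _); exact: mulrCA.
have := pA x x0; have := pB x x0; rewrite !ltcE.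
case: (tdot _ _) (tdot _ _) => p q [p' q'] /= /andP[/eqP-> hp] /andP[/eqP-> hp'].
rewrite !mul0r !mulr0 !subr0 !addr0 eqxx /=.
have -> : r * p + (1 - r) * p' = interp r p p' by rewrite /interp addrC.
by apply: interp_gt0 => //; rewrite r0.
Qed.

(** * Trace forms in eigenvector coordinates *)

Lemma ttrace_real I (X : tensor R I I) : thermitian X -> ttrace X \is Num.real.
Proof.
move=> hX; apply/CrealP; rewrite /ttrace rmorph_sum; apply: eq_bigr => i _ /=.
by rewrite -[in RHS]hX ffunE.
Qed.

Lemma Re_ttraceD I (X Y : tensor R I I) :
  complex.Re (ttrace (X + Y)) = complex.Re (ttrace X) + complex.Re (ttrace Y).
Proof.
rewrite -raddfD -big_split; congr complex.Re.
by apply: eq_bigr => i _; rewrite ffunE.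
Qed.

Lemma Re_ttraceZ I (r : R) (X : tensor R I I) :
  complex.Re (ttrace (r%:C%C *: X)) = r * complex.Re (ttrace X).
Proof.
rewrite -[RHS](_ : complex.Re (r%:C%C * ttrace X) = _); last first.
  by case: (ttrace X) => a b /=; rewrite mul0r subr0.
by rewrite mulr_sumr; congr complex.Re; apply: eq_bigr => i _; rewrite ffunE.
Qed.

Lemma ttrace_mulC I J (X : tensor R I J) (Y : tensor R J I) :
  ttrace (X *e Y) = ttrace (Y *e X).
Proof.
rewrite /ttrace; under eq_bigr do rewrite ffunE /=.
rewrite exchange_big; apply: eq_bigr => j _ /=.
by rewrite ffunE; apply: eq_bigr => i _ /=; rewrite mulrC.
Qed.

(** All traces of the proof are of this shape: it is the real Hilbert-Schmidt
    pairing of [X] with [Y] after multiplying [Y] by [A] on the left and by [T]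
    on the right. These two operations commute, and for Hermitian [A] and [T]
    they are diagonalized together. *)
Definition trform I J (A : tensor R I I) (T : tensor R J J)
    (X Y : tensor R I J) : R :=
  complex.Re (ttrace (X^H *e A *e Y *e T)).

Lemma trform_addl I J (A B : tensor R I I) (T : tensor R J J) X Y :
  trform (A + B) T X Y = trform A T X Y + trform B T X Y.
Proof. by rewrite /trform einprodDr !einprodDl Re_ttraceD. Qed.

Lemma trform0l I J (T : tensor R J J) (X Y : tensor R I J) : trform 0 T X Y = 0.
Proof. by have := trform_addl 0 0 T X Y; rewrite addr0 -[LHS]addr0 => /addrI. Qed.

Lemma trform_suml I J (N : nat) (F : 'I_N -> tensor R I I)
    (T : tensor R J J) X Y :
  trform (\sum_i F i) T X Y = \sum_i trform (F i) T X Y.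
Proof.
apply: (big_morph (fun A => trform A T X Y)) => [A B|]; first exact: trform_addl.
exact: trform0l.
Qed.

Lemma trform_mixl I J r (A B : tensor R I I) (T : tensor R J J) X Y :
  trform (tmix r A B) T X Y = r * trform A T X Y + (1 - r) * trform B T X Y.
Proof.
rewrite /trform einprodDr !einprodDl !einprodZr !einprodZl Re_ttraceD.
by congr (_ + _); exact: Re_ttraceZ.
Qed.

Lemma trform_mixr I J r (A : tensor R I I) (T S : tensor R J J) X Y :
  trform A (tmix r T S) X Y = r * trform A T X Y + (1 - r) * trform A S X Y.
Proof.
rewrite /trform einprodDr !einprodZr Re_ttraceD.
by congr (_ + _); exact: Re_ttraceZ.
Qed.

Lemma trform_id I (A T : tensor R I I) :
  trform A T (tid R I) (tid R I) = complex.Re (ttrace (A *e T)).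
Proof.
by rewrite /trform einprod1r -(einprod1r (tid R I)^H) (tunitary_id I).1 einprod1l.
Qed.

Lemma trform_congr I J (A : tensor R I I) (T : tensor R J J)
    (U : tensor R I J) :
  trform (U^H *e A *e U) T (tid R J) (tid R J) = trform A T U U.
Proof.
by rewrite /trform einprod1r -(einprod1r (tid R J)^H) (tunitary_id J).1 einprod1l.
Qed.

Definition rdot (x y : R[i]) : R :=
  complex.Re x * complex.Re y + complex.Im x * complex.Im y.

Lemma rdot_ge0 (x : R[i]) : 0 <= rdot x x.
Proof. by rewrite /rdot addr_ge0 // -expr2 sqr_ge0. Qed.

(** Completing the square: the difference of the two sides is
    [|z w - x d|^2 / w]. *)
Lemma rdot_young (x z : R[i]) (d w : R) : 0 < w ->
  2 * (rdot z x * d) - rdot z z * w <= rdot x x * (d ^+ 2 / w).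
Proof.
move=> w0; rewrite [leRHS]mulrA ler_pdivlMr // -subr_ge0.
have -> : rdot x x * d ^+ 2 - (2 * (rdot z x * d) - rdot z z * w) * w =
    (complex.Re z * w - complex.Re x * d) ^+ 2 +
    (complex.Im z * w - complex.Im x * d) ^+ 2 by rewrite /rdot; ring.
by rewrite addr_ge0 ?sqr_ge0.
Qed.

Lemma rdot_young_eq (x : R[i]) (d w : R) : 0 < w ->
  let z := (d / w)%:C%C * x in
  2 * (rdot z x * d) - rdot z z * w = rdot x x * (d ^+ 2 / w).
Proof. by move=> w0; case: x => p q; rewrite /rdot /=; field; rewrite gt_eqF. Qed.

(** Left multiplication by [A] and right multiplication by [T] become diagonal
    in the matrix coordinates between the eigenbasis of [T] and that of [A]. *)
Lemma trform_spec I J (V : tensor R I I) (W : tensor R J J) g f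
    (X Y : tensor R I J) :
  trform (tspec V g) (tspec W f) X Y =
  \sum_j \sum_i g i * f j *
     rdot ((V^H *e X *e W) (i, j)) ((V^H *e Y *e W) (i, j)).
Proof.
rewrite /trform /tspec.
have -> : X^H *e (V *e tdiag g *e V^H) *e Y *e (W *e tdiag f *e W^H) =
   (X^H *e V *e (tdiag g *e (V^H *e Y *e W) *e tdiag f)) *e W^H.
  by rewrite !einprodA.
rewrite ttrace_mulC einprodA.
have -> : W^H *e (X^H *e V) = (V^H *e X *e W)^H.
  by rewrite !tctrM tctrK einprodA.
move: (V^H *e X *e W) (V^H *e Y *e W) => x y.
rewrite /ttrace raddf_sum; apply: eq_bigr => j _ /=.
rewrite ffunE raddf_sum; apply: eq_bigr => i _ /=.
rewrite einprod_diagr einprod_diagl ffunE /=.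
case: (x (i, j)) (y (i, j)) => a b [c d]; rewrite /rdot /=; ring.
Qed.

Lemma trform_onel I J (V : tensor R I I) (W : tensor R J J) f X Y :
  tunitary V -> tunitary W ->
  trform (tid R I) (tspec W f) X Y =
  \sum_j \sum_i f j * rdot ((V^H *e X *e W) (i, j)) ((V^H *e Y *e W) (i, j)).
Proof.
move=> uV uW; rewrite -(tspec1 uV) trform_spec.
by apply: eq_bigr => j _; apply: eq_bigr => i _; rewrite mul1r.
Qed.

Lemma trform_oner I J (V : tensor R I I) (W : tensor R J J) g X Y :
  tunitary V -> tunitary W ->
  trform (tspec V g) (tid R J) X Y =
  \sum_j \sum_i g i * rdot ((V^H *e X *e W) (i, j)) ((V^H *e Y *e W) (i, j)).
Proof.
move=> uV uW; rewrite -(tspec1 uW) trform_spec.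
by apply: eq_bigr => j _; apply: eq_bigr => i _; rewrite mulr1.
Qed.

(** * Joint convexity of the relative entropy *)

(** For [U = 1] this is the relative entropy Tr(T log T) - Tr(T log A); with
    general [U] it is Petz's quasi-entropy. *)
Definition rel_entropy I J (U : tensor R I J) (T : tensor R J J)
    (A : tensor R I I) : R :=
  trform (tid R I) (tlog T *e T) U U - trform (tlog A) T U U.

Lemma rel_entropy_spec I J (U : tensor R I J) V W a b :
  tunitary V -> tunitary W ->
  let x := V^H *e U *e W in
  rel_entropy U (tspec W a) (tspec V b) =
  \sum_j \sum_i rdot (x (i, j)) (x (i, j)) * (a j * (ln (a j) - ln (b i))).
Proof.
move=> uV uW /=; rewrite /rel_entropy !tlog_spec // tspecM // -(tspec1 uV).
rewrite !trform_spec -sumrB; apply: eq_bigr => j _.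
by rewrite -sumrB; apply: eq_bigr => i _; ring.
Qed.

(** In eigenvector coordinates, with [d = a_j - b_i] and
    [w = (1 - s) b_i + s a_j], this is a sum of
    [|x|^2 d + (1 - s) (2 d Re(conj z x) - |z|^2 w)], whose maximum over [z] is
    [|x|^2] times [resolvent_kernel s a_j b_i = d + (1 - s) d^2 / w]. For fixed
    [Z], it is linear in the pair [(T, A)]. *)
Definition minorant s I J (Z U : tensor R I J) (T : tensor R J J)
    (A : tensor R I I) : R :=
  trform (tid R I) T U U - trform A (tid R J) U U
  + (1 - s) * (2 * (trform (tid R I) T Z U - trform A (tid R J) Z U)
               - ((1 - s) * trform A (tid R J) Z Z + s * trform (tid R I) T Z Z)).

Lemma minorant_mix s I J (Z U : tensor R I J) r T T' A A' :
  minorant s Z U (tmix r T T') (tmix r A A') =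
  r * minorant s Z U T A + (1 - r) * minorant s Z U T' A'.
Proof. rewrite /minorant !trform_mixl !trform_mixr; ring. Qed.

Lemma minorant_spec s I J (Z U : tensor R I J) V W a b :
  tunitary V -> tunitary W ->
  let x := V^H *e U *e W in let z := V^H *e Z *e W in
  minorant s Z U (tspec W a) (tspec V b) =
  \sum_j \sum_i
    (rdot (x (i, j)) (x (i, j)) * (a j - b i)
     + (1 - s) * (2 * (rdot (z (i, j)) (x (i, j)) * (a j - b i))
                  - rdot (z (i, j)) (z (i, j)) * interp s (a j) (b i))).
Proof.
move=> uV uW /=; rewrite /minorant -(tspec1 uV) -(tspec1 uW) !trform_spec.
rewrite -!sumrB !mulr_sumr -!big_split -sumrB mulr_sumr -big_split.
apply: eq_bigr => j _ /=.
rewrite -!sumrB !mulr_sumr -!big_split -sumrB mulr_sumr -big_split.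
by apply: eq_bigr => i _ /=; rewrite /interp; ring.
Qed.

Lemma riemann_mean_sum n I J (c : midx J -> midx I -> R)
    (F : midx J -> midx I -> R -> R) :
  riemann_mean n (fun s => \sum_j \sum_i c j i * F j i s) =
  \sum_j \sum_i c j i * riemann_mean n (F j i).
Proof.
rewrite /riemann_mean exchange_big mulr_sumr; apply: eq_bigr => j _ /=.
rewrite exchange_big mulr_sumr; apply: eq_bigr => i _ /=.
by rewrite -mulr_sumr mulrCA.
Qed.

Lemma ler_riemann_mean n f g :
  (forall s : R, 0 <= s <= 1 -> f s <= g s) ->
  riemann_mean n f <= riemann_mean n g.
Proof.
case: n => [|n] fg; first by rewrite /riemann_mean !big_ord0.
rewrite /riemann_mean ler_pM2l ?invr_gt0 ?ltr0n //.
by apply: ler_sum => k _; apply/fg/node01.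
Qed.

(** Termwise, [rdot_young] bounds the minorant by the kernel, for every choice of
    [Z], and the Riemann means of the kernel stay below the relative entropy. *)
Lemma minorant_le_rel_entropy n I J (Z : R -> tensor R I J)
    (U : tensor R I J) T A :
  (0 < n)%N -> tposdef T -> tposdef A ->
  riemann_mean n (fun s => minorant s (Z s) U T A) <= rel_entropy U T A.
Proof.
move=> n0 /tposdefP[W [a [uW -> a0]]] /tposdefP[V [b [uV -> b0]]].
rewrite rel_entropy_spec //; set x := V^H *e U *e W.
pose F := fun s => \sum_j \sum_i
  rdot (x (i, j)) (x (i, j)) * resolvent_kernel s (a j) (b i).
apply: (@le_trans _ _ (riemann_mean n F)); last first.
  rewrite riemann_mean_sum; apply: ler_sum => j _; apply: ler_sum => i _.
  by rewrite ler_wpM2l ?rdot_ge0 //; have /andP[] := entropy_riemann n0 (a0 j) (b0 i).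
apply: ler_riemann_mean => s s01; rewrite minorant_spec //.
apply: ler_sum => j _; apply: ler_sum => i _.
rewrite /resolvent_kernel [leRHS]mulrDr lerD2l [leRHS]mulrCA ler_wpM2l //.
  by case/andP: s01; lra.
by apply: rdot_young; exact: interp_gt0.
Qed.

(** Together with [minorant_le_rel_entropy], this exhibits the relative entropy
    as the supremum of Riemann means of minorants: [c] does not depend on [n],
    so the error vanishes as [n] grows. *)
Lemma rel_entropy_le_minorant I J (U : tensor R I J) T A :
  tposdef T -> tposdef A ->
  exists c : R, forall n, (0 < n)%N -> exists Z : R -> tensor R I J,
  rel_entropy U T A <=
  riemann_mean n (fun s => minorant s (Z s) U T A) + c / n%:R.
Proof.
move=> /tposdefP[W [a [uW -> a0]]] /tposdefP[V [b [uV -> b0]]].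
rewrite rel_entropy_spec //; set x := V^H *e U *e W.
pose c := \sum_j \sum_i
  rdot (x (i, j)) (x (i, j)) * ((a j - b i) ^+ 2 / b i).
exists c => n n0.
(* The maximizer in the inequality [rdot_young]. *)
pose z s : tensor R I J :=
  [ffun p => ((a p.2 - b p.1) / interp s (a p.2) (b p.1))%:C%C * x p].
exists (fun s => V *e z s *e W^H).
pose F := fun s => \sum_j \sum_i
  rdot (x (i, j)) (x (i, j)) * resolvent_kernel s (a j) (b i).
apply: (@le_trans _ _ (riemann_mean n F + c / n%:R)).
  rewrite riemann_mean_sum mulr_suml -big_split; apply: ler_sum => j _ /=.
  rewrite mulr_suml -big_split; apply: ler_sum => i _ /=.
  rewrite -mulrA -mulrDr ler_wpM2l ?rdot_ge0 //.
  by have /andP[] := entropy_riemann n0 (a0 j) (b0 i).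
rewrite lerD2r; apply: ler_riemann_mean => s s01; rewrite minorant_spec //.
have -> : V^H *e (V *e z s *e W^H) *e W = z s.
  by rewrite !einprodA uV.1 einprod1l -einprodA uW.1 einprod1r.
apply: ler_sum => j _; apply: ler_sum => i _.
rewrite /resolvent_kernel [leLHS]mulrDr lerD2l [leLHS]mulrCA.
have -> : z s (i, j) = ((a j - b i) / interp s (a j) (b i))%:C%C * x (i, j).
  by rewrite ffunE.
by rewrite rdot_young_eq //; exact: interp_gt0.
Qed.

(** At the mixed point choose nearly optimal tensors [Z]; the corresponding mean
    of minorants is affine, and at the two end points it stays below the
    relative entropy. *)
Lemma rel_entropy_convex I J (U : tensor R I J) r T T' A A' : 0 <= r <= 1 ->
  tposdef T -> tposdef T' -> tposdef A -> tposdef A' ->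
  rel_entropy U (tmix r T T') (tmix r A A') <=
  r * rel_entropy U T A + (1 - r) * rel_entropy U T' A'.
Proof.
move=> r01 pT pT' pA pA'.
have pS := tposdef_mix r01 pT pT'; have pB := tposdef_mix r01 pA pA'.
have [c hc] := rel_entropy_le_minorant U pS pB.
apply: (@le_archimedean _ _ _ c) => n n0; have [Z /le_trans] := hc n n0; apply.
rewrite lerD2r.
have -> : riemann_mean n
      (fun s => minorant s (Z s) U (tmix r T T') (tmix r A A')) =
  r * riemann_mean n (fun s => minorant s (Z s) U T A) +
  (1 - r) * riemann_mean n (fun s => minorant s (Z s) U T' A').
  rewrite /riemann_mean !(mulrCA _ n%:R^-1) -mulrDr !mulr_sumr -big_split mulr_sumr.
  by apply: eq_bigr => k _ /=; rewrite minorant_mix.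
case/andP: r01 => r0 r1; apply: lerD; apply: ler_wpM2l; rewrite ?subr_ge0 //.
all: exact: minorant_le_rel_entropy.
Qed.

End Tensors.

(** * The variational principle and the theorem *)

Section Gibbs.
Context (R : realType) (M : nat) (I : 'I_M -> nat).
Implicit Types T K : tensor R I I.

Local Notation one := (tid R I).

Definition free_energy K T : R :=
  trform K T one one - trform one (tlog T *e T) one one + trform one T one one.

(** In eigenvector coordinates this is the scalar inequality
    [a (1 + k - ln a) <= expR k], that is, [1 + x <= expR x] at
    [x = k - ln a]. *)
Lemma free_energy_le K T : thermitian K -> tposdef T ->
  free_energy K T <= complex.Re (ttrace (texp K)).
Proof.
move=> /thermitian_spec[V [k [uV ->]]] /tposdefP[W [a [uW -> a0]]].
rewrite -[texp _](einprod1r) -trform_id texp_spec // /free_energy.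
rewrite tlog_spec // tspecM //.
rewrite !(trform_onel _ _ _ uV uW) (trform_oner _ _ _ uV uW) trform_spec.
rewrite -sumrN -!big_split; apply: ler_sum => j _ /=.
rewrite -sumrN -!big_split; apply: ler_sum => i _ /=.
set p := rdot _ _; have p0 : 0 <= p by exact: rdot_ge0.
rewrite -mulNr -!mulrDl ler_wpM2r //.
have := expR_ge1Dx (k i - ln (a j)).
rewrite expRB lnK ?posrE // ler_pdivlMr //; lra.
Qed.

Lemma free_energy_texp K : thermitian K ->
  free_energy K (texp K) = complex.Re (ttrace (texp K)).
Proof.
move=> hK; rewrite /free_energy texpK // !trform_id !einprod1l.
by rewrite subrr add0r.
Qed.

Context (N : nat) (H : tensor R I I) (U : 'I_N -> tensor R I I).

Definition exponent (A : 'I_N -> tensor R I I) : tensor R I I :=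
  H + \sum_(i < N) (U i)^H *e tlog (A i) *e U i.

Lemma exponent_hermitian (A : 'I_N -> tensor R I I) :
  thermitian H -> (forall i, tposdef (A i)) ->
  thermitian (exponent A).
Proof.
move=> hH pA; rewrite /thermitian /exponent tctrD hH tctr_sum; congr (_ + _).
apply: eq_bigr => i _; rewrite !tctrM tctrK einprodA.
have [V [d [uV -> _]]] := tposdefP (pA i).
by rewrite tlog_spec // (tspec_hermitian V).
Qed.

(** The tensor [U0] carries the part of the identity that the [U i] leave out;
    it is paired with the identity tensor, whose logarithm is zero. *)
Lemma free_energy_decomposition (U0 : tensor R I I)
    (A : 'I_N -> tensor R I I) T :
  U0^H *e U0 + \sum_(i < N) (U i)^H *e U i = one ->
  free_energy (exponent A) T =
  trform H T one one + trform one T one one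
  - (rel_entropy U0 T one + \sum_(i < N) rel_entropy (U i) T (A i)).
Proof.
move=> UU; rewrite /free_energy /rel_entropy tlog_id trform0l subr0.
have -> : trform one (tlog T *e T) one one = trform one (tlog T *e T) U0 U0 +
    \sum_i trform one (tlog T *e T) (U i) (U i).
  rewrite -{1}UU trform_addl trform_suml -(trform_congr one) einprod1r.
  by congr (_ + _); apply: eq_bigr => i _; rewrite -(trform_congr one) einprod1r.
rewrite /exponent trform_addl trform_suml sumrB.
under eq_bigr do rewrite trform_congr.
ring.
Qed.

(** The optimal [T] for the two end points are mixed; the result is a trial
    point for the variational principle at the mixed [A]. *)
Lemma trace_exp_concave r (A A' : 'I_N -> tensor R I I) : thermitian H ->
  tle (\sum_(i < N) (U i)^H *e U i) one -> 0 <= r <= 1 ->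
  (forall i, tposdef (A i)) -> (forall i, tposdef (A' i)) ->
  r * complex.Re (ttrace (texp (exponent A))) +
  (1 - r) * complex.Re (ttrace (texp (exponent A'))) <=
  complex.Re (ttrace (texp (exponent (fun i => tmix r (A i) (A' i))))).
Proof.
move=> hH /tpsd_gram[U0 UU] r01 pA pA'.
have {}UU : U0^H *e U0 + \sum_(i < N) (U i)^H *e U i = one by rewrite -UU subrK.
have hK := exponent_hermitian hH pA; have hK' := exponent_hermitian hH pA'.
rewrite -(free_energy_texp hK) -(free_energy_texp hK').
have := tposdef_texp hK; have := tposdef_texp hK'.
move: (texp _) (texp _) => T T' pT' pT.
have pmix i := tposdef_mix r01 (pA i) (pA' i).
have hKmix := exponent_hermitian hH pmix.
apply: le_trans (free_energy_le hKmix (tposdef_mix r01 pT pT')).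
rewrite !(free_energy_decomposition _ _ UU) !trform_mixr.
have := rel_entropy_convex U0 r01 pT pT' (tposdef_id R I) (tposdef_id R I).
rewrite tmix_id => e0.
have : \sum_(i < N) rel_entropy (U i) (tmix r T T') (tmix r (A i) (A' i)) <=
   r * (\sum_(i < N) rel_entropy (U i) T (A i)) +
   (1 - r) * (\sum_(i < N) rel_entropy (U i) T' (A' i)).
  rewrite !mulr_sumr -big_split; apply: ler_sum => i _.
  exact: rel_entropy_convex.
move: e0; lra.
Qed.

End Gibbs.

Theorem theorem2 (R : realType) (M : nat) (I : 'I_M -> nat) (N : nat)
    (H : tensor R I I) (U : 'I_N -> tensor R I I) :
  thermitian H ->
  tle (\sum_(i < N) (U i)^H *e U i) (tid R I) ->
  concave_on
    [set A : {ffun 'I_N -> tensor R I I} | forall i, tposdef (A i)]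
    (fun A => ttrace (texp (H + \sum_(i < N) (U i)^H *e tlog (A i) *e U i))).
Proof.
move=> hH UU.
have real_weight (t : {i01 R[i]}) :
    exists r : R, (0 <= r <= 1) /\ t%:num = r%:C%C.
  have t0 : 0 <= t%:num by [].
  have t1 : t%:num <= 1 by [].
  exists (complex.Re t%:num); split; last by rewrite RRe_real // ger0_real.
  by move: t0 t1; rewrite !lecE => /andP[_ ->] /andP[_ ->].
pose mix t (A A' : convex_lmodType {ffun 'I_N -> tensor R I I}) :
  {ffun 'I_N -> tensor R I I} := conv t A A'.
have mixE (A A' : {ffun 'I_N -> tensor R I I}) (t : {i01 R[i]}) r i :
    t%:num = r%:C%C -> mix t A A' i = tmix r (A i) (A' i).
  move=> tr; rewrite /tmix -tr /mix /conv /= 3!ffunE; congr (_ + _).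
  suff -> : unstable.onem t%:num = (1 - r)%:C%C by [].
  by rewrite /unstable.onem tr rmorphB rmorph1.
have trR (A : {ffun 'I_N -> tensor R I I}) : (forall i, tposdef (A i)) ->
    ttrace (texp (exponent H U A)) \is Num.real.
  move=> pA; apply/ttrace_real/(tposdef_texp _).1.
  exact: exponent_hermitian.
have mixD t (A A' : {ffun 'I_N -> tensor R I I}) :
    (forall i, tposdef (A i)) -> (forall i, tposdef (A' i)) ->
    forall i, tposdef (mix t A A' i).
  move=> pA pA' i; have [r [r01 tr]] := real_weight t.
  by rewrite (mixE _ _ _ _ _ tr); exact: tposdef_mix.
split.
- by move=> A A' t; rewrite !inE /= => pA pA'; exact: (mixD t A A').
- by move=> A; rewrite inE => pA; exact: trR.
- move=> t A A'; rewrite !inE => pA pA'.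
  have [r [r01 tr]] := real_weight t.
  have := trace_exp_concave hH UU r01 pA pA'.
  have -> : (fun i => tmix r (A i) (A' i)) = mix t A A'.
    by apply/funext => i; rewrite -(mixE _ _ _ _ _ tr).
  rewrite -lecR rmorphD !rmorphM rmorphB rmorph1 /= -tr.
  by rewrite !RRe_real ?trR //; exact: mixD.
Qed.
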